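(* Let $\Gamma$ be a distance-regular graph with valency $k\geq 3$ and diameter $D\geq 3$. If $a_D=0$ and $k_{D-1}<2k$, then one of the following holds: (i) $k_D=1$ and $\Gamma$ is an antipodal $2$-cover; (ii) $D=3$ and $\Gamma$ is bipartite.
   Context: A connected graph $\Gamma$ with diameter $D$ is distance-regular if there are integers $b_i,c_i$ ($0\le i\le D$) such that for any two vertices $x,y$ at distance $i$, exactly $c_i$ neighbours of $y$ are at distance $i-1$ from $x$ and exactly $b_i$ neighbours of $y$ are at distance $i+1$ from $x$ (with $b_D=c_0=0$); its valency is $k=b_0$ and $a_i=k-b_i-c_i$. For a vertex $x$, $k_i$ is the number of vertices at distance exactly $i$ from $x$ (independent of $x$). A connected graph of diameter $D>1$ is antipodal if being at distance $0$ or $D$ is an equivalence relation on its vertices; it is an antipodal $r$-cover if moreover all equivalence classes have size $r$. A graph is bipartite if it has no odd cycle. *)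

(* Defs.v *)
From mathcomp Require Import all_boot all_order all_algebra.

Set Implicit Arguments.
Unset Strict Implicit.
Unset Printing Implicit Defensive.

Section Graphs.

Variables (T : finType) (e : rel T).

Definition simple_graph : Prop := symmetric e /\ irreflexive e.

Definition connected_graph : Prop := forall x y, connect e x y.

Definition walk (n : nat) (x y : T) : bool :=
  [exists p : n.-tuple T, path e x p && (last x p == y)].

(* The least length of a walk from x to y; a shortest walk repeats no vertex,
   so its length is < #|T|. Disconnected pairs get the junk value #|T|. *)
Definition dist (x y : T) : nat :=
  find (fun n => walk n x y) (iota 0 #|T|).

Definition diameter : nat := \max_(x : T) \max_(y : T) dist x y.

(* k_i is #|sphere x i|, the same for every x in a distance-regular graph. *)
Definition sphere (x : T) (i : nat) : {set T} := [set y | dist x y == i].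

Definition neighbours (y : T) : {set T} := [set z | e y z].

(* "z at distance i - 1" is written (dist x z).+1 = i, so that nothing
   qualifies when i = 0. *)
Definition distance_regular (D : nat) (b c : nat -> nat) : Prop :=
  [/\ connected_graph,
      diameter = D,
      b D = 0 /\ c 0 = 0
    & forall (i : nat) (x y : T), i <= D -> dist x y = i ->
        #|[set z in neighbours y | (dist x z).+1 == i]| = c i /\
        #|[set z in neighbours y | dist x z == i.+1]| = b i].

Definition antipodal_rel : rel T :=
  [rel x y | (dist x y == 0) || (dist x y == diameter)].

Definition antipodal : Prop :=
  [/\ connected_graph, 1 < diameter & equivalence_rel antipodal_rel].

Definition antipodal_cover (r : nat) : Prop :=
  antipodal /\ forall x, #|[set y | antipodal_rel x y]| = r.

Definition bipartite : Prop :=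
  forall p : seq T, 2 < size p -> ucycle e p -> ~~ odd (size p).

End Graphs.

(* a_i = k - b_i - c_i with k = b_0, in int to avoid truncated subtraction. *)
Definition intersection_a (b c : nat -> nat) (i : nat) : int :=
  ((b 0)%:Z - (b i)%:Z - (c i)%:Z)%R.

(* Main.v *)
(** If [k_D > 1], two vertices of [Γ_D(x)] have [2k > k_{D-1}] neighbours, with
    multiplicity, in [Γ_{D-1}(x)], so they are at distance 2. Double counting gives
    [k_D k = k_{D-1} b_{D-1}], hence [k_D < 2 b_{D-1}] and any two vertices of
    [Γ_{D-1}(x)] are at distance at most 2. Now take [y] in [Γ_D(x)], [z != x] in
    [Γ_D(y)] and a neighbour [w] of [z] at distance 3 from [x]: both [w] and all
    the neighbours of [x] lie in [Γ_{D-1}(y)], so [b_3 = 0] and [D = 3]. In that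
    case no vertex is at distance 2 from both [x] and [y]; applied to the
    neighbours of [z] this gives [a_2 = 0], and [a_1 = 0] follows because
    [Γ_1(x)] is contained in [Γ_2(y)]. *)
Require Import Defs.
From mathcomp Require Import all_boot all_order all_algebra.
From mathcomp Require Import zify.

Set Implicit Arguments.
Unset Strict Implicit.
Unset Printing Implicit Defensive.

(** * Distances in a connected graph *)

Section Distance.

Variables (T : finType) (e : rel T).

Lemma walkP (n : nat) (x y : T) :
  reflect (exists p, [/\ size p = n, path e x p & last x p = y])
          (walk e n x y).
Proof.
apply: (iffP existsP) => [[p /andP[ep /eqP lp]]|[p [sp ep lp]]].
  by exists p; rewrite size_tuple.
by exists (tcast sp (in_tuple p)); rewrite val_tcast /= ep lp eqxx.
Qed.

Lemma dist_le_card (x y : T) : dist e x y <= #|T|.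
Proof. by rewrite -[#|T|](size_iota 0) find_size. Qed.

Lemma dist_le_walk (n : nat) (x y : T) : walk e n x y -> dist e x y <= n.
Proof.
move=> w; rewrite leqNgt; apply/negP => lt_n.
have := before_find 0 lt_n; rewrite nth_iota ?add0n ?w //.
exact: leq_trans lt_n (dist_le_card x y).
Qed.

Lemma dist_walk (x y : T) : connect e x y -> walk e (dist e x y) x y.
Proof.
(* Shortening to a duplicate-free path brings the length below [#|T|], inside the range that [dist]
   searches, so [find] does not return its default value. *)
move=> /connectP[p0 ep0 ->]; case/shortenP: ep0 => p ep up _.
have ltp : size p < #|T|.
  by rewrite -[(size p).+1]/(size (x :: p)) -(card_uniqP up) max_card.
have hw : has (fun n => walk e n x (last x p)) (iota 0 #|T|).
  apply/hasP; exists (size p); first by rewrite mem_iota.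
  by apply/walkP; exists p.
have := nth_find 0 hw; rewrite nth_iota ?add0n //.
by move: hw; rewrite has_find size_iota.
Qed.

Lemma distxx (x : T) : dist e x x = 0.
Proof. by apply/eqP; rewrite -leqn0; apply/dist_le_walk/walkP; exists [::]. Qed.

Hypotheses (gr : simple_graph e) (con : connected_graph e).

Lemma dist_eq0 (x y : T) : (dist e x y == 0) = (x == y).
Proof.
apply/eqP/eqP => [d0|->]; last exact: distxx.
by have /walkP[p [+ _ <-]] := dist_walk (con x y); rewrite d0 => /size0nil ->.
Qed.

Lemma dist_triangle (y x z : T) : dist e x z <= dist e x y + dist e y z.
Proof.
have /walkP[p [<- ep lp]] := dist_walk (con x y).
have /walkP[q [<- eq lq]] := dist_walk (con y z).
apply/dist_le_walk/walkP; exists (p ++ q).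
by rewrite size_cat cat_path last_cat lp ep eq.
Qed.

Lemma dist_sym_le (x y : T) : dist e y x <= dist e x y.
Proof.
have /walkP[p [<- ep <-]] := dist_walk (con x y).
apply/dist_le_walk/walkP; exists (rev (belast x p)); split.
- by rewrite size_rev size_belast.
- rewrite rev_path; apply: sub_path ep => a b /=.
  by rewrite (proj1 gr).
- by case: p {ep} => //= a p; rewrite rev_cons last_rcons.
Qed.

Lemma dist_sym (x y : T) : dist e x y = dist e y x.
Proof. by apply/eqP; rewrite eqn_leq !dist_sym_le. Qed.

Lemma edge_dist (x y : T) : e x y -> dist e x y = 1.
Proof.
move=> exy; apply/eqP; rewrite eqn_leq lt0n dist_eq0; apply/andP; split.
  by apply/dist_le_walk/walkP; exists [:: y]; rewrite /= exy.
by apply: contraTneq exy => ->; rewrite (proj2 gr).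
Qed.

Lemma edge_dist_le (x y z : T) : e y z -> dist e x z <= (dist e x y).+1.
Proof. by move=> eyz; rewrite -addn1 -(edge_dist eyz) dist_triangle. Qed.

Lemma dist_pred (n : nat) (x y : T) :
  dist e x y = n.+1 -> exists2 z, e z y & dist e x z = n.
Proof.
move=> dxy; have /walkP[p [+ + +]] := dist_walk (con x y); rewrite dxy.
case/lastP: p => // p w; rewrite size_rcons rcons_path last_rcons.
move=> [sp] /andP[ep ew] wy; rewrite {w}wy in ew.
exists (last x p) => //; apply/eqP; rewrite eqn_leq -[n <= _]ltnS -dxy.
by rewrite edge_dist_le // andbT; apply/dist_le_walk/walkP; exists p.
Qed.

Lemma dist_interp (n m : nat) (x y : T) :
  dist e x y = n -> m <= n -> exists z, dist e x z = m.
Proof.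
elim: n y => [|n IHn] y dxy; first by rewrite leqn0 => /eqP->; exists y.
rewrite leq_eqVlt => /predU1P[->|]; first by exists y.
by have [z _ dxz] := dist_pred dxy; apply: IHn dxz.
Qed.

Lemma dist_le_diameter (x y : T) : dist e x y <= diameter e.
Proof.
exact: leq_trans (leq_bigmax (F := dist e x) y)
  (leq_bigmax (F := fun x => \max_y dist e x y) x).
Qed.

Lemma diameter_attained (x0 : T) : exists x y, dist e x y = diameter e.
Proof.
have T0 : 0 < #|T| by apply/card_gt0P; exists x0.
have [x dx] := eq_bigmax (fun x => \max_y dist e x y) T0.
have [y dy] := eq_bigmax (dist e x) T0.
by exists x, y; rewrite /diameter dx dy.
Qed.

End Distance.

(** The parity of the distance from [x] is a proper 2-colouring: it flips at each step of a walk, so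
    a closed walk has even length. *)
Lemma bipartite_dist (T : finType) (e : rel T) (x : T) :
  (forall u v, e u v -> odd (dist e x v) = ~~ odd (dist e x u)) -> bipartite e.
Proof.
move=> par.
have parp u p : path e u p ->
    odd (dist e x (last u p)) = odd (dist e x u) (+) odd (size p).
  elim: p u => [|v p IHp] u /=; first by rewrite addbF.
  by case/andP=> /par euv /IHp ->; rewrite euv addNb addbN.
case=> // u p _ /andP[/= /parp + _]; rewrite last_rcons size_rcons /=.
by case: (odd _); case: (odd _).
Qed.

(** * Distance-regular graphs *)

Section DistanceRegular.

Variables (T : finType) (e : rel T) (D : nat) (b c : nat -> nat).
Hypotheses (gr : simple_graph e) (dr : distance_regular e D b c).

Let con : connected_graph e. Proof. by case: dr. Qed.

Lemma drg_dist_le (x y : T) : dist e x y <= D.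
Proof. by case: dr => _ <- _ _; exact: dist_le_diameter. Qed.

Lemma card_neighbours (x : T) : #|neighbours e x| = b 0.
Proof.
have [_ _ _ /(_ 0 x x (leq0n D) (distxx e x))[_ <-]] := dr.
apply: eq_card => z; rewrite !inE.
by case exz: (e x z) => //=; rewrite (edge_dist gr con exz).
Qed.

Lemma drg_c (i : nat) (x y : T) : dist e x y = i.+1 ->
  #|[set z in neighbours e y | dist e x z == i]| = c i.+1.
Proof.
move=> dxy; have [_ _ _ /(_ i.+1 x y)[]//] := dr.
by rewrite -dxy drg_dist_le.
Qed.

Lemma drg_b (i : nat) (x y : T) : dist e x y = i ->
  #|[set z in neighbours e y | dist e x z == i.+1]| = b i.
Proof.
move=> dxy; have [_ _ _ /(_ i x y)[]//] := dr.
by rewrite -dxy drg_dist_le.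
Qed.

(** [x0] makes [T] nonempty, so the diameter is attained; truncating a shortest walk then realises
    every smaller distance. *)
Lemma drg_exists_dist (x0 : T) (i : nat) : i <= D ->
  exists x y, dist e x y = i.
Proof.
move=> leiD; have [x [y dxy]] := diameter_attained e x0.
exists x; apply: (dist_interp gr con dxy).
by case: dr => _ -> _ _.
Qed.

Lemma drg_c_gt0 (x0 : T) (i : nat) : i < D -> 0 < c i.+1.
Proof.
move=> /(drg_exists_dist x0)[x [y dxy]].
have [z ezy dxz] := dist_pred gr con dxy.
rewrite -(drg_c dxy); apply/card_gt0P; exists z.
by rewrite !inE (proj1 gr) ezy dxz eqxx.
Qed.

Lemma drg_b_gt0 (x0 : T) (i : nat) : i < D -> 0 < b i.
Proof.
move=> /(drg_exists_dist x0)[x [y dxy]].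
have [z ezy dxz] := dist_pred gr con dxy.
rewrite -(drg_b dxz); apply/card_gt0P; exists y.
by rewrite !inE ezy dxy eqxx.
Qed.

Lemma drg_b_neighbour (i : nat) (x y : T) : i < D -> dist e x y = i ->
  exists2 z, e y z & dist e x z = i.+1.
Proof.
move=> ltiD dxy; have := drg_b_gt0 x ltiD; rewrite -(drg_b dxy).
by case/card_gt0P=> z; rewrite !inE => /andP[eyz /eqP dxz]; exists z.
Qed.

(** Distances from [x] to adjacent vertices differ by at most 1, so the neighbours of [y] split into
    three classes; the first one has size [a_(i+1)]. *)
Lemma drg_sum_neighbours (i : nat) (x y : T) : dist e x y = i.+1 ->
  #|[set z in neighbours e y | dist e x z == i.+1]| + (c i.+1 + b i.+1) = b 0.
Proof.
move=> dxy; rewrite -(drg_c dxy) -(drg_b dxy) -(card_neighbours y).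
rewrite -!sum1_card !(big_mkcond (fun z => z \in _)) -!big_split /=.
apply: eq_bigr => z _; rewrite !inE; case eyz: (e y z) => //=.
have := edge_dist_le gr con x eyz; rewrite (proj1 gr) in eyz.
have := edge_dist_le gr con x eyz; rewrite dxy.
by case: eqP => ?; case: eqP => ?; case: eqP => ? /=; lia.
Qed.

(** Since [a_(i+1)] does not depend on the pair, being nonzero at one pair makes it nonzero at any
    other. *)
Lemma drg_a_neighbour (i : nat) (x y z x' y' : T) :
  dist e x y = i.+1 -> dist e x' y' = i.+1 -> e y z -> dist e x z = i.+1 ->
  exists2 z', e y' z' & dist e x' z' = i.+1.
Proof.
move=> dxy dxy' eyz dxz.
have : 0 < #|[set z in neighbours e y' | dist e x' z == i.+1]|.
  have := drg_sum_neighbours dxy; rewrite -(drg_sum_neighbours dxy').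
  move/addIn => <-; apply/card_gt0P; exists z.
  by rewrite !inE eyz dxz eqxx.
by case/card_gt0P=> z'; rewrite !inE => /andP[? /eqP ?]; exists z'.
Qed.

(** Both sides count the edges between the two consecutive spheres around [x]. *)
Lemma sphere_double_count (x : T) (i : nat) :
  #|sphere e x i.+1| * c i.+1 = #|sphere e x i| * b i.
Proof.
rewrite -!sum_nat_const.
transitivity (\sum_(y in sphere e x i.+1) \sum_(z in sphere e x i) (e y z : nat)).
  apply: eq_bigr => y; rewrite inE => /eqP dxy.
  rewrite -(drg_c dxy) -sum1_card [RHS]big_mkcond [LHS]big_mkcond /=.
  by apply: eq_bigr => z _; rewrite !inE; case: (e y z); case: (_ == _).
rewrite exchange_big /=; apply: eq_bigr => z; rewrite inE => /eqP dxz.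
rewrite -(drg_b dxz) -sum1_card [RHS]big_mkcond [LHS]big_mkcond /=.
apply: eq_bigr => y _; rewrite !inE (proj1 gr y z).
by case: (e z y); case: (_ == _).
Qed.

Lemma card_sphere_const (i : nat) (x y : T) : i <= D ->
  #|sphere e x i| = #|sphere e y i|.
Proof.
elim: i => [_|i IHi ltiD].
  have s0 u : #|sphere e u 0| = 1.
    rewrite -(cards1 u); apply: eq_card => v.
    by rewrite !inE dist_eq0 // eq_sym.
  by rewrite !s0.
(* The double count determines [k_(i+1)] from [k_i], because [c i.+1] is positive and cancels. *)
apply/eqP; rewrite -(eqn_pmul2r (drg_c_gt0 x ltiD)).
by rewrite !sphere_double_count IHi // ltnW.
Qed.

Lemma card_sphere_gt0 (i : nat) (x : T) : i <= D -> 0 < #|sphere e x i|.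
Proof.
move=> leiD; have [u [v duv]] := drg_exists_dist x leiD.
by rewrite (card_sphere_const x u leiD); apply/card_gt0P; exists v; rewrite inE duv.
Qed.

Lemma antipodal_cover2 : 1 < D -> (forall x, #|sphere e x D| = 1) ->
  antipodal_cover e 2.
Proof.
move=> D1 s1; have diamD : diameter e = D by case: dr.
(* The antipode is unique, so the class of [x] is the pair of [x] and [y]; transitivity and the
   class size follow from this. *)
have sub2 x y : dist e x y = D -> antipodal_rel e x =1 pred2 x y.
  move=> dxy z; rewrite /antipodal_rel /= diamD dist_eq0 // eq_sym; congr (_ || _).
  have /eqP/cards1P[w sw] := s1 x.
  have : y \in sphere e x D by rewrite inE dxy.
  by rewrite sw inE => /eqP ->; move/setP/(_ z): sw; rewrite !inE.
split.
  split=> // [|x y z]; first by rewrite diamD.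
  split; first by rewrite /antipodal_rel /= distxx.
  case/orP; first by rewrite dist_eq0 // => /eqP ->.
  rewrite diamD => /eqP dxy; rewrite (sub2 _ _ dxy).
  by rewrite dist_sym // in dxy; rewrite (sub2 _ _ dxy) /= orbC.
move=> x; have [y] := card_gt0P (card_sphere_gt0 x (leqnn D)).
rewrite inE => /eqP dxy; have nxy : x != y.
  by rewrite -(dist_eq0 con) dxy; case: (D) D1.
rewrite -[RHS](_ : #|[set x; y]| = 2); last by rewrite cards2 nxy.
by apply: eq_card => z; rewrite [LHS]inE (sub2 _ _ dxy) !inE.
Qed.

End DistanceRegular.

Lemma card_setI_gt0 (T : finType) (S A B : {set T}) :
  A \subset S -> B \subset S -> #|S| < #|A| + #|B| ->
  exists z, z \in A :&: B.
Proof.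
move=> AS BS ltS; apply/card_gt0P.
have : #|A :|: B| <= #|S| by rewrite subset_leq_card // subUset AS.
by have := cardsUI A B; lia.
Qed.

(** * Distance-regular graphs with [a_D = 0] and [k_D > 1] *)

Section NoEdgesInLastSphere.

Variables (T : finType) (e : rel T) (D : nat) (b c : nat -> nat).
Hypotheses (gr : simple_graph e) (dr : distance_regular e D b c).
Hypotheses (hD : 3 <= D) (cD : c D = b 0).
Hypothesis small : forall x, #|sphere e x D.-1| < 2 * b 0.
Hypothesis large : forall x, 1 < #|sphere e x D|.

Let con : connected_graph e. Proof. by case: dr. Qed.
Let DS : D = D.-1.+1. Proof. by case: (D) hD. Qed.

(** As [c D] equals the valency, the neighbours counted by [c D] are all the neighbours of [y]. *)
Lemma neighbour_last_sphere (x y z : T) :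
  dist e x y = D -> e y z -> dist e x z = D.-1.
Proof.
rewrite {1}DS => /(drg_c dr); rewrite -DS cD -(card_neighbours gr dr y) => cN.
have /setP/(_ z) : [set z in neighbours e y | dist e x z == D.-1] = neighbours e y.
  apply/eqP; rewrite eqEcard cN leqnn andbT; apply/subsetP => w.
  by rewrite !inE => /andP[].
by rewrite !inE => + eyz; rewrite eyz => /eqP.
Qed.

Lemma last_sphere_dist2 (x y z : T) :
  dist e x y = D -> dist e x z = D -> y != z -> dist e y z = 2.
Proof.
move=> dy dz nyz.
have sub u : dist e x u = D -> neighbours e u \subset sphere e x D.-1.
  move=> du; apply/subsetP => v; rewrite !inE => euv.
  by rewrite (neighbour_last_sphere du euv).
have [] := card_setI_gt0 (sub y dy) (sub z dz).
  by rewrite !(card_neighbours gr dr) addnn -mul2n.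
move=> w; rewrite !inE => /andP[eyw ezw].
have := dist_triangle con w y z; rewrite (dist_sym gr con w).
rewrite (edge_dist gr con eyw) (edge_dist gr con ezw) => le2.
have : dist e y z != 0 by rewrite dist_eq0.
(* Adjacent [y] and [z] would put [z] at distance [D.-1] from [x] as well as [D]. *)
have : dist e y z != 1.
  apply/eqP => dyz; have [v evz /eqP] := dist_pred gr con dyz.
  rewrite dist_eq0 // => /eqP yv; rewrite -yv in evz.
  by have := neighbour_last_sphere dy evz; lia.
by move: le2; case: (dist e y z) => [|[|[|]]].
Qed.

Lemma prelast_sphere_dist_le2 (x u v : T) :
  dist e x u = D.-1 -> dist e x v = D.-1 -> dist e u v <= 2.
Proof.
move=> du dv; pose up w := [set z in neighbours e w | dist e x z == D].
have cup w : dist e x w = D.-1 -> #|up w| = b D.-1.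
  by move=> /(drg_b dr); rewrite -DS.
have sub w : up w \subset sphere e x D.
  by apply/subsetP => z; rewrite !inE => /andP[].
have [] := card_setI_gt0 (sub u) (sub v).
  (* With [s * b 0 = t * b D.-1] and [t < 2 * b 0], the bound [s < 2 * b D.-1] follows once [b D.-1]
     is nonzero, which [1 < s] ensures. *)
  rewrite !cup //; have := sphere_double_count gr dr x D.-1.
  rewrite -DS cD; have := small x; have := large x.
  rewrite addnn -mul2n; set s := #|sphere e x D|; set t := #|sphere e x D.-1|.
  by nia.
move=> w; rewrite !inE => /andP[/andP[euw _] /andP[evw _]].
have := dist_triangle con w u v; rewrite (dist_sym gr con w).
by rewrite (edge_dist gr con euw) (edge_dist gr con evw).
Qed.

(** Take [z] in the last sphere of [y], other than [x]; two distinct vertices of that sphere are at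
    distance 2. *)
Lemma second_antipode (x y : T) : dist e x y = D ->
  exists z, dist e x z = 2 /\ dist e y z = D.
Proof.
move=> dxy; have := large y; rewrite (cardsD1 x) inE (dist_sym gr con) dxy eqxx.
rewrite ltnS => /card_gt0P[z]; rewrite !inE => /andP[nzx /eqP dyz].
exists z; split=> //; apply: last_sphere_dist2 dyz _; last by rewrite eq_sym.
by rewrite dist_sym.
Qed.

Lemma diameter_eq3 (x : T) : D = 3.
Proof.
apply/eqP; rewrite eqn_leq hD andbT leqNgt; apply/negP => D4.
have [y] := card_gt0P (card_sphere_gt0 gr dr x (leqnn D)).
rewrite inE => /eqP dxy; have [z [dxz dyz]] := second_antipode dxy.
have [w ezw dxw] := drg_b_neighbour gr dr hD dxz.
have dyw := neighbour_last_sphere dyz ezw.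
(* The base point moves to [w]: if [3 < D], some neighbour [v] of [x] is at distance 4 from [w], yet
   both [v] and [w] are at distance [D.-1] from [y]. *)
rewrite (dist_sym gr con) in dxw; rewrite (dist_sym gr con) in dxy.
have [v exv dwv] := drg_b_neighbour gr dr D4 dxw.
have dyv := neighbour_last_sphere dxy exv.
by have := prelast_sphere_dist_le2 dyw dyv; rewrite dwv.
Qed.

Lemma edge_dist_neq (x u v : T) : e u v -> dist e x u != dist e x v.
Proof.
move=> euv; have D3 := diameter_eq3 x.
have nbr w1 w2 t : dist e w1 w2 = 3 -> e w2 t -> dist e w1 t = 2.
  by move=> d12 e2; rewrite (neighbour_last_sphere _ e2) D3.
have far w : exists y, dist e w y = 3.
  have [y] := card_gt0P (card_sphere_gt0 gr dr w (leqnn D)).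
  by rewrite inE D3 => /eqP; exists y.
(* An edge inside a sphere of radius 2 can be transported to the pair [x], [z]. The resulting [z']
   is at distance 2 from [x], and from [y] as a neighbour of [z]. Then [x] and [y] both lie in the
   second sphere of [z'], contradicting their distance 3. *)
have a2 w s t : e s t -> dist e w s = 2 -> dist e w t = 2 -> False.
  move=> est ds dt; have [y dxy] := far x.
  have [z [dxz dyz]] := second_antipode (etrans dxy (esym D3)).
  have [z' ezz' dxz'] := drg_a_neighbour gr dr ds dxz est dt.
  rewrite D3 in dyz; have dyz' := nbr _ _ _ dyz ezz'.
  rewrite (dist_sym gr con) in dxz'; rewrite (dist_sym gr con) in dyz'.
  have le2 := prelast_sphere_dist_le2 (x := z') (u := x) (v := y).
  by rewrite D3 /= dxy in le2; have := le2 dxz' dyz'.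
(* Case analysis on the common distance: 0 would give a loop, 1 reduces to [a2] seen from an
   antipode [y] of [x], 2 is [a2] itself, and 3 contradicts [nbr]. *)
apply/eqP => duv; have := drg_dist_le dr x u; rewrite D3.
case du: (dist e x u) duv => [|[|[|[|//]]]] /esym dv _.
- move/eqP: du; move/eqP: dv; rewrite !dist_eq0 // => /eqP xv /eqP xu.
  by move: euv; rewrite -xu -xv (proj2 gr).
- have adj s : dist e x s = 1 -> e x s.
    by move=> /(dist_pred gr con)[r ers /eqP]; rewrite dist_eq0 // => /eqP ->.
  have [y] := far x; rewrite (dist_sym gr con) => dyx.
  exact: a2 euv (nbr _ _ _ dyx (adj u du)) (nbr _ _ _ dyx (adj v dv)).
- exact: a2 euv du dv.
- by have := nbr _ _ _ du euv; rewrite dv.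
Qed.

End NoEdgesInLastSphere.

Theorem theorem12 (T : finType) (e : rel T) (D : nat) (b c : nat -> nat)
    (x : T)
    (he : simple_graph e)
    (hdr : distance_regular e D b c)
    (hk : 3 <= b 0)
    (hD : 3 <= D)
    (ha : intersection_a b c D = 0%R)
    (hkD : #|sphere e x D.-1| < 2 * b 0) :
  (#|sphere e x D| = 1 /\ antipodal_cover e 2) \/
  (D = 3 /\ bipartite e).
Proof.
have con : connected_graph e by case: hdr.
(* Since [b D = 0], the condition [a_D = 0] says that [c D] is the valency. *)
have cD : c D = b 0.
  case: hdr => _ _ [bD _] _; move/eqP: ha.
  by rewrite /intersection_a bD GRing.subr0 GRing.subr_eq0 => /eqP[].
have kD y : #|sphere e y D| = #|sphere e x D|.
  exact: (card_sphere_const he hdr y x (leqnn D)).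
have [k1|] := eqVneq #|sphere e x D| 1.
  left; split=> //; apply: (antipodal_cover2 he hdr) => [|y]; first exact: ltnW.
  by rewrite kD.
move=> kneq1; right; have k0 := card_sphere_gt0 he hdr x (leqnn D).
have large y : 1 < #|sphere e y D| by rewrite kD ltn_neqAle eq_sym kneq1.
have small y : #|sphere e y D.-1| < 2 * b 0.
  by rewrite (card_sphere_const he hdr y x (leq_pred D)).
split; first exact: (diameter_eq3 he hdr hD cD small large x).
(* The distances from [x] to the ends of an edge differ by at most 1 and are unequal, so their
   parities differ. *)
apply: (@bipartite_dist _ _ x) => u v euv.
have := edge_dist_neq he hdr hD cD small large x euv.
have := edge_dist_le he con x euv; rewrite (proj1 he) in euv.
by have := edge_dist_le he con x euv; lia.
Qed.
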